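(* Let $n\ge2$. The type $B_n$ zeta map $\zeta_B:\mathcal L_{n,n}\to\mathcal B_{2n}$ is a bijection.
   Context: $\mathcal L_{n,n}$: words in $\{N,E\}$ with $n$ letters of each kind; $\mathcal B_{2n}$: words of length $2n$ all of whose prefixes have at least as many $N$'s as $E$'s. For $\pi\in\mathcal L_{n,n}$ let $\pi_i$ be the number of East steps before the $i$-th North step; set $\lambda_i=\pi_i$ for $i<n$ and $\lambda_n=2\pi_n-\pi_{n-1}$ if $\pi_1+\dots+\pi_{n-2}$ is even, $\lambda_n=2n+1-2\pi_n+\pi_{n-1}$ if odd. Type $B_n$ area vector: $\mu_i=\lambda_i-i$ for $i<n$, and $\mu_n=\lambda_n-n$ if $n\equiv0,3\pmod4$, $\mu_n=n+1-\lambda_n$ if $n\equiv1,2\pmod4$. For $a\in\mathbb Z^n$, $j\ge0$: $\overrightarrow{S}^+_j(a)$ reads $a$ left to right writing $N$ for entries $j$ and $E$ for entries $j+1$; $\overleftarrow{S}^+_j(a)$ reads right to left; $\overrightarrow{S}^-_j,\overleftarrow{S}^-_j$ likewise with $N$ for $-j$ and $E$ for $-j-1$. $\zeta_B(\pi)=\overleftarrow{S}^-_{2n}(\mu)\overrightarrow{S}^+_{2n}(\mu)\overleftarrow{S}^-_{2n-1}(\mu)\overrightarrow{S}^+_{2n-1}(\mu)\cdots\overleftarrow{S}^-_1(\mu)\overrightarrow{S}^+_1(\mu)\overleftarrow{S}^-_0(\mu)\big(N\overrightarrow{S}^+_0(\mu)\big)^\circ$, where $(\cdot)^\circ$ deletes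 the last letter. *)

(* Defs.v *)
From mathcomp Require Import all_boot all_order all_algebra.
From mathcomp Require Import all_classical.

Set Implicit Arguments.
Unset Strict Implicit.
Unset Printing Implicit Defensive.

Import Order.TTheory GRing.Theory Num.Theory.

Local Open Scope classical_set_scope.
Local Open Scope ring_scope.

Definition step := bool.
Definition North : step := true.
Definition East : step := false.

Definition lattice_paths (n : nat) : set (seq step) :=
  [set w | count_mem North w = n /\ count_mem East w = n].

Definition ballot_paths (m : nat) : set (seq step) :=
  [set w | size w = m /\
     forall u : seq step,
       prefix u w -> (count_mem East u <= count_mem North u)%N].

Definition easts_before_norths (w : seq step) : seq nat :=
  [seq count_mem East (take k w) | k <- iota 0 (size w) & nth East w k == North].

(* Indices i are 1-based in [pi_], [lambda_] and [mu_]; only 1 <= i <= n is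
   meaningful. *)
Definition pi_ (w : seq step) (i : nat) : nat :=
  nth 0%N (easts_before_norths w) i.-1.

Definition lambda_ (n : nat) (w : seq step) (i : nat) : int :=
  if (i < n)%N then (pi_ w i)%:Z
  else if ~~ odd (\sum_(1 <= k < n.-1) pi_ w k)%N
  then 2 * (pi_ w n)%:Z - (pi_ w n.-1)%:Z
  else 2 * n%:Z + 1 - 2 * (pi_ w n)%:Z + (pi_ w n.-1)%:Z.

Definition mu_ (n : nat) (w : seq step) (i : nat) : int :=
  if (i < n)%N then lambda_ n w i - i%:Z
  else if (n %% 4 == 0)%N || (n %% 4 == 3)%N then lambda_ n w n - n%:Z
  else n%:Z + 1 - lambda_ n w n.

Definition area_vector (n : nat) (w : seq step) : seq int :=
  [seq mu_ n w i | i <- iota 1 n].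

Definition read_word (x y : int) (a : seq int) : seq step :=
  pmap (fun z : int => if z == x then Some North
                       else if z == y then Some East else None) a.

Definition Sright_pos (j : nat) (a : seq int) : seq step :=
  read_word j%:Z (j%:Z + 1) a.
Definition Sright_neg (j : nat) (a : seq int) : seq step :=
  read_word (- j%:Z) (- j%:Z - 1) a.
Definition Sleft_neg (j : nat) (a : seq int) : seq step :=
  read_word (- j%:Z) (- j%:Z - 1) (rev a).

Definition delete_last (w : seq step) : seq step := take (size w).-1 w.

Definition zetaB (n : nat) (w : seq step) : seq step :=
  let mu := area_vector n w in
  flatten [seq Sleft_neg j mu ++ Sright_pos j mu | j <- rev (iota 1 (2 * n))]
    ++ Sleft_neg 0 mu ++ delete_last (North :: Sright_pos 0 mu).

(* Main.v *)
(* Extend the area vector [mu] to the antisymmetric sequence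
   [-mu_n, ..., -mu_1, 0, mu_1, ..., mu_n]: the zeta map reads its levels
   [2n, ..., 0] from left to right, with letter [N] for [j] and [E] for [j + 1].
   Consecutive entries go down by at most 1.  Moving the first entry [k] to the
   end as [k + 1] does not change the concatenated word, so the last entry [b]
   may be exchanged with [1 - b] and assumed nonpositive; the parity of the sum
   of the entries, which is always even, tells the two apart.  With [b <= 0]
   every nonempty level word ends in [N], so that the word can be cut into level
   words from right to left, and these determine the sequence since its steps
   are at least -1.  Hence the map is injective, and the number of ballot paths
   of length [2n] equals the number of lattice paths. *)

Require Import Defs.
From mathcomp Require Import all_boot all_order all_algebra.
From mathcomp Require Import all_classical.
From mathcomp Require Import zify.

Import Order.TTheory GRing.Theory Num.Theory.

Local Open Scope ring_scope.

(** * Concatenations of words indexed by decreasing levels *)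

Definition sweep (f : nat -> seq step) (m : nat) : seq step :=
  flatten [seq f j | j <- rev (iota 0 m)].

Lemma sweepS f m : sweep f m.+1 = f m ++ sweep f m.
Proof. by rewrite /sweep -addn1 iotaD rev_cat. Qed.

Lemma sweepSr f m : sweep f m.+1 = sweep (fun j => f j.+1) m ++ f 0%N.
Proof.
by elim: m => [|m IHm]; [rewrite /sweep /= cats0 | rewrite !sweepS -catA -IHm -sweepS].
Qed.

Lemma eq_sweep f g m :
  (forall j, (j < m)%N -> f j = g j) -> sweep f m = sweep g m.
Proof.
elim: m => // m IHm fg; rewrite !sweepS fg // IHm // => j jm.
exact/fg/ltnW.
Qed.

Section Chain.

Variable f : nat -> seq step.
Hypothesis count_f : forall j, count_mem East (f j) = count_mem North (f j.+1).

(** The sum telescopes: the [East] letters of word [j] are as many as the [North] letters of word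
    [j + 1]. *)
Lemma count_sweep m :
  (count_mem North (sweep f m) + count_mem North (f m) =
   count_mem North (f 0%N) + count_mem East (sweep f m))%N.
Proof.
elim: m => [|m IHm]; first by rewrite addnC.
by rewrite sweepS !count_cat; have := count_f m; lia.
Qed.

(** Each word has its [East] letters paid for by the [North] letters of the word one level up. Only
    the top word has no such word before it, hence the extra term. *)
Lemma sweep_ballot m u : prefix u (sweep f m) ->
  (count_mem East u <= count_mem North u + count_mem North (f m))%N.
Proof.
elim: m u => [|m IHm] u; first by rewrite prefixs0 => /eqP ->.
rewrite sweepS; case: (leqP (size u) (size (f m))) => [le_u | lt_u].
  move=> /prefixP [v def_u].
  have : prefix u (f m).
    by rewrite -(take_size_cat (s1 := u) v erefl) -def_u takel_cat // prefix_take.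
  by move=> /prefixP [t ft]; have := count_f m; rewrite {1}ft count_cat; lia.
move=> /prefixP [v def_u].
have def_u' : u = f m ++ drop (size (f m)) u.
  rewrite -{1}(cat_take_drop (size (f m)) u); congr (_ ++ _).
  by rewrite -[RHS](take_size_cat (s1 := f m) (sweep f m) erefl) def_u takel_cat // ltnW.
have : prefix (drop (size (f m)) u) (sweep f m).
  move: def_u; rewrite def_u' -catA => /eqP.
  by rewrite eqseq_cat // eqxx => /eqP ->; rewrite drop_size_cat // prefix_prefix.
move=> /IHm; rewrite {3 4}def_u' !count_cat; have := count_f m; lia.
Qed.

End Chain.

(* As [a] is empty or ends in [North], [x] is the longest suffix of [a ++ x]
   having its number of [North] letters. *)
Lemma suffix_unique (a b x y : seq step) :
  last North a = North -> last North b = North ->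
  count_mem North x = count_mem North y -> a ++ x = b ++ y -> x = y.
Proof.
have wlog_le (a' b' x' y' : seq step) : (size x' <= size y')%N ->
    last North a' = North ->
    count_mem North x' = count_mem North y' -> a' ++ x' = b' ++ y' -> x' = y'.
  move=> le_xy last_a eq_xy eq_cat.
  have le_ba : (size b' <= size a')%N.
    by have := congr1 size eq_cat; rewrite !size_cat; lia.
  have def_a : a' = b' ++ drop (size b') a'.
    rewrite -{1}(cat_take_drop (size b') a'); congr (_ ++ _).
    by rewrite -[RHS](take_size_cat (s1 := b') y' erefl) -eq_cat takel_cat.
  set d := drop _ _ in def_a.
  have def_y : y' = d ++ x'.
    by move/eqP: eq_cat; rewrite def_a -catA eqseq_cat // eqxx => /eqP ->.
  have : last North d = North.
    by move: last_a; rewrite def_a last_cat; case: (d).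
  have : count_mem North d = 0%N by rewrite def_y count_cat in eq_xy; lia.
  rewrite def_y; case/lastP: (d) => // s z; rewrite last_rcons => + zN.
  by rewrite zN -cats1 count_cat /= addnS.
move=> last_a last_b eq_xy eq_cat.
case: (leqP (size x) (size y)) => [le | /ltnW le]; first exact: wlog_le eq_cat.
by symmetry; apply: wlog_le (esym eq_cat).
Qed.

Lemma last_sweep f m :
  (forall j, last North (f j) = North) -> last North (sweep f m) = North.
Proof.
by move=> last_f; elim: m => // m IHm; rewrite sweepS last_cat last_f.
Qed.

(** The words are peeled off from level 0 upwards. Once a word is known, its [East] letters give the
    number of [North] letters in the next one, which is what [suffix_unique] needs to make the
    cut. *)
Lemma sweep_inj m f g :
  (forall j, last North (f j) = North) -> (forall j, last North (g j) = North) ->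
  (forall j, count_mem East (f j) = count_mem North (f j.+1)) ->
  (forall j, count_mem East (g j) = count_mem North (g j.+1)) ->
  count_mem North (f 0%N) = count_mem North (g 0%N) ->
  sweep f m = sweep g m -> forall j, (j < m)%N -> f j = g j.
Proof.
elim: m f g => // m IHm f g lf lg cf cg fg0; rewrite !sweepSr => fg.
have eq0 : f 0%N = g 0%N by apply: suffix_unique fg => //; apply: last_sweep.
case=> // j; rewrite ltnS => jm.
apply: (IHm (fun j => f j.+1) (fun j => g j.+1)) => //; first by rewrite -cf -cg eq0.
move: fg; rewrite eq0 => fg; have := congr1 size fg; rewrite !size_cat => szfg.
by move/eqP: fg; rewrite eqseq_cat; [case/andP=> /eqP | exact: addIn szfg].
Qed.

(** * The level words of an integer sequence *)

Definition level (j : int) (s : seq int) : seq step := read_word j (j + 1) s.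

Arguments level : simpl never.

Lemma level_cons j x s : level j (x :: s) =
  if x == j then North :: level j s
  else if x == j + 1 then East :: level j s else level j s.
Proof. by rewrite /level /read_word /=; case: (x == j) => //; case: eqP. Qed.

Lemma level_cat j s t : level j (s ++ t) = level j s ++ level j t.
Proof. exact: pmap_cat. Qed.

Lemma level_rcons j x s : level j (rcons s x) = level j s ++ level j [:: x].
Proof. by rewrite -cats1 level_cat. Qed.

Lemma count_North_level j s : count_mem North (level j s) = count_mem j s.
Proof.
elim: s => // x s IHs; rewrite level_cons /= -IHs.
by case: ifP => // _; case: ifP.
Qed.

Lemma count_East_level j s : count_mem East (level j s) = count_mem (j + 1) s.
Proof.
elim: s => // x s IHs; rewrite level_cons /= -IHs.
case: eqP => [->|_]; first by have -> : (j == j + 1) = false by lia.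
by case: ifP.
Qed.

Definition descent_ok : rel int := fun x y => x - 1 <= y.

(* Discrete intermediate values: steps go down by at most 1, so [j + 1] is met
   before [j]. *)
Lemma level_head j x s : j + 1 <= x -> path descent_ok x s ->
  ohead (level j (x :: s)) <> Some North.
Proof.
elim: s x => [|y s IHs] x jx; rewrite level_cons.
  have -> : (x == j) = false by lia.
  by case: ifP.
move=> /= /andP [xy ps]; have -> : (x == j) = false by lia.
case: eqP => // xj; apply: IHs => //; rewrite /descent_ok in xy; lia.
Qed.

(** After the last visit to [j + 1], getting down to at most [j] by steps of at least -1 forces a
    visit to [j]. The default [East] in the second part expresses that the word is also nonempty. *)
Lemma level_last j x s : path descent_ok x s -> last x s <= j ->
  last North (level j (x :: s)) = North /\
  (j <= x -> last East (level j (x :: s)) = North).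
Proof.
elim: s x => [|y s IHs] x /=.
  move=> _ xj; rewrite level_cons /=.
  case: eqP => xj1 //; case: eqP => //; split=> //; lia.
move=> /andP [xy ps] /(IHs _ ps) [lN lE]; rewrite level_cons.
rewrite /descent_ok in xy.
case: eqP => [//|xj]; case: eqP => [xj1|xj1]; first by split=> [|_]; apply: lE; lia.
split=> // jx; apply: lE; lia.
Qed.

(** If the first entries were [x < y], level [x] would start with [North] for [s], which
    [level_head] forbids for [t]. Equal first entries contribute the same letters and can be
    removed. *)
Lemma level_inj s t : sorted descent_ok s -> sorted descent_ok t ->
  (forall j, level j s = level j t) -> s = t.
Proof.
elim: s t => [|x s IHs] [|y t] //.
- by move=> _ _ /(_ y); rewrite level_cons eqxx.
- by move=> _ _ /(_ x); rewrite level_cons eqxx.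
move=> ps pt st; have [lt_xy|lt_yx|def_y] := ltgtP x y.
- have := @level_head x y t; rewrite -st level_cons eqxx; case=> //; lia.
- have := @level_head y x s; rewrite st level_cons eqxx; case=> //; lia.
congr (_ :: _) => //; apply: IHs; [exact: path_sorted ps | exact: path_sorted pt |].
move=> j; have := st j; rewrite !level_cons def_y.
by case: ifP => _ => [[]|] //; case: ifP => _ => [[]|].
Qed.

Lemma level_rev_opp j s :
  level (- j - 1) (rev [seq - x | x <- s]) = rev [seq ~~ b | b <- level j s].
Proof.
elim: s => // x s IHs; rewrite /= rev_cons level_rcons IHs !level_cons.
have -> : (- x == - j - 1) = (x == j + 1) by lia.
have -> : (- x == - j - 1 + 1) = (x == j) by lia.
case: (x =P j + 1) => [->|_].
  have -> : (j + 1 == j) = false by lia.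
  by rewrite /= rev_cons cats1.
by case: ifP => _; rewrite /= ?rev_cons ?cats1 ?cats0.
Qed.

(** * Antisymmetric sequences *)

Definition levels (s : seq int) : nat -> seq step := fun j => level j%:Z s.

Arguments levels : simpl never.

Lemma levels_count s j :
  count_mem East (levels s j) = count_mem North (levels s j.+1).
Proof. by rewrite count_East_level count_North_level -addn1 PoszD. Qed.

Definition mirror (s : seq int) : seq int := rev [seq - x | x <- s] ++ 0 :: s.

Lemma rev_opp_mirror s : rev [seq - x | x <- mirror s] = mirror s.
Proof.
rewrite /mirror map_cat rev_cat map_rev revK /= rev_cons oppr0 cat_rcons.
by rewrite mapK //; apply: opprK.
Qed.

Lemma mirror_inj : injective mirror.
Proof.
move=> s t st; have sz : size s = size t.
  by have := congr1 size st; rewrite !size_cat !size_rev !size_map /=; lia.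
move/eqP: st; rewrite eqseq_cat ?size_rev ?size_map //.
by case/andP=> _ /eqP [].
Qed.

Lemma mirror_rcons s b : mirror (rcons s b) = - b :: rcons (mirror s) b.
Proof. by rewrite /mirror map_rcons rev_rcons /= -!cats1 -catA. Qed.

(** A step from [x] to [y] becomes a step from [- y] to [- x], with the same difference. *)
Lemma sorted_rev_opp s :
  sorted descent_ok (rev [seq - x | x <- s]) = sorted descent_ok s.
Proof.
rewrite rev_sorted sorted_map; apply: eq_sorted => x y /=.
by rewrite /descent_ok; lia.
Qed.

Lemma sorted_mirror s : path descent_ok 0 s -> sorted descent_ok (mirror s).
Proof.
move=> ps; have : sorted descent_ok (rev [seq - x | x <- 0 :: s]).
  by rewrite sorted_rev_opp.
rewrite /= rev_cons oppr0 /mirror.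
case: (rev _) => [|x t] //=; rewrite cat_path rcons_path => /andP [-> /= ->].
exact: ps.
Qed.

Lemma last_mirror s : last 0 s <= 0 -> last 0 (mirror s) <= 0.
Proof. by rewrite last_cat. Qed.

Lemma level_out (j : int) s : (forall x, x \in s -> x < j) -> level j s = [::].
Proof.
elim: s => // x s IHs lt_s; rewrite level_cons IHs => [|y ys]; last first.
  by apply: lt_s; rewrite inE ys orbT.
have := lt_s x; rewrite inE eqxx => /(_ isT) => xj.
have -> : (x == j) = false by lia.
by have -> : (x == j + 1) = false by lia.
Qed.

Lemma levels_last s j : path descent_ok 0 s -> last 0 s <= 0 ->
  last North (levels (mirror s) j) = North.
Proof.
move=> /sorted_mirror + /last_mirror; case: (mirror s) => // x t pt lt.
have lt' : last x t <= j%:Z by apply: le_trans lt _.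
by have [] := @level_last _ _ _ pt lt'.
Qed.

Lemma mem_mirror s (x : int) : x \in mirror s -> [|| x == 0, x \in s | - x \in s].
Proof.
rewrite mem_cat inE mem_rev; case/or3P => [/mapP [y ys ->]|->|->] //.
  by rewrite opprK ys !orbT.
by rewrite orbT.
Qed.

Lemma sweep_levels_inj m s t : (0 < m)%N ->
  path descent_ok 0 s -> path descent_ok 0 t ->
  last 0 s <= 0 -> last 0 t <= 0 ->
  (forall x, x \in s -> `|x| < m%:Z) -> (forall x, x \in t -> `|x| < m%:Z) ->
  sweep (levels (mirror s)) m = sweep (levels (mirror t)) m -> s = t.
Proof.
move=> m_gt0 ps pt ls lt bs bt st.
have out (u : seq int) j : (m <= j)%N -> (forall x, x \in u -> `|x| < m%:Z) ->
    levels (mirror u) j = [::].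
  by move=> mj bu; apply: level_out => x /mem_mirror /or3P [/eqP ->|/bu|/bu]; lia.
(* Level [m] is empty, so [count_sweep] gives the number of zeros as the excess of [North] over
   [East] in the whole word. *)
have eq0 : count_mem North (levels (mirror s) 0) = count_mem North (levels (mirror t) 0).
  have := count_sweep _ (levels_count (mirror s)) m.
  have := count_sweep _ (levels_count (mirror t)) m.
  by rewrite st !(out _ m) //; lia.
have eq_levels (j : nat) : level j (mirror s) = level j (mirror t).
  case: (ltnP j m) => [jm|mj]; last by rewrite -!/(levels _ _) !out.
  apply: (@sweep_inj m _ _ _ _ _ _ eq0 st j jm); try exact: levels_count.
    by move=> i; apply: levels_last.
  by move=> i; apply: levels_last.
apply/mirror_inj/level_inj; try exact: sorted_mirror.
case=> j; first exact: eq_levels.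
(* Antisymmetry recovers a negative level from a nonnegative one, reversed and with its letters
   exchanged. *)
have -> : Negz j = - j%:Z - 1 by lia.
by rewrite -(rev_opp_mirror s) -(rev_opp_mirror t) !level_rev_opp eq_levels.
Qed.

(** * Rotation of the end entries and length of the swept word *)

Lemma delete_last_rcons s x : delete_last (rcons s x) = s.
Proof. by rewrite /delete_last size_rcons -cats1 take_size_cat. Qed.

Lemma delete_last_cat s t : t != [::] -> delete_last (s ++ t) = s ++ delete_last t.
Proof.
by case/lastP: t => // t x _; rewrite -rcons_cat !delete_last_rcons.
Qed.

Lemma sweepD f m d :
  sweep f (d + m)%N = sweep (fun j => f (j + m)%N) d ++ sweep f m.
Proof. by elim: d => // d IHd; rewrite addSn !sweepS IHd catA. Qed.

Lemma level_ends j x s y :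
  level j (x :: rcons s y) = level j [:: x] ++ level j s ++ level j [:: y].
Proof. by rewrite -cats1 -!level_cat. Qed.

Lemma level1 j x : level j [:: x] =
  if x == j then [:: North] else if x == j + 1 then [:: East] else [::].
Proof. by rewrite level_cons. Qed.

(* Moving the first entry [k] to the end as [k + 1] moves its letters [N], [E]
   from the start of levels [k] and [k - 1] to the end of levels [k + 1] and
   [k], that is, across the boundary between consecutive words. *)
Lemma sweep_rotate (k m : nat) s : (k.+1 < m)%N -> 0 \in s ->
  delete_last (sweep (levels (k%:Z :: rcons s (- k%:Z))) m) =
  delete_last (sweep (levels (- (k%:Z + 1) :: rcons s (k%:Z + 1))) m).
Proof.
move=> km s0; set f := levels _; set g := levels _.
have fE j : f j = level j [:: k%:Z] ++ levels s j ++ level j [:: - k%:Z].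
  exact: level_ends.
have gE j : g j = level j [:: - (k%:Z + 1)] ++ levels s j ++ level j [:: k%:Z + 1].
  exact: level_ends.
rewrite -(subnK km) !sweepD.
have -> : sweep (fun j => f (j + k.+2)%N) (m - k.+2) =
          sweep (fun j => g (j + k.+2)%N) (m - k.+2).
  apply: eq_sweep => j _; rewrite fE gE !level1.
  by do ?(case: ifP => ?; try lia).
have g_low : sweep g k = sweep (levels s) k.
  apply: eq_sweep => j jk; rewrite gE !level1.
  by do ?(case: ifP => ?; try lia); rewrite cats0.
have g0 : g k = levels s k ++ [:: East].
  by rewrite gE !level1; do ?(case: ifP => ?; try lia).
have g1 : g k.+1 = levels s k.+1 ++ [:: North].
  by rewrite gE !level1; do ?(case: ifP => ?; try lia).
have f1 : f k.+1 = levels s k.+1.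
  by rewrite fE !level1; do ?(case: ifP => ?; try lia); rewrite cats0.
(* For [k = 0] the entry [- k] is seen at level 0 too: the full words end in different letters,
   [North] and [East], and agree only after the deletion. For positive [k] they agree as they
   are. *)
case: k => [|k] in f g km fE gE g_low g0 g1 f1 *.
  have f0 : f 0%N = North :: rcons (levels s 0) North.
    by rewrite fE !level1; do ?(case: ifP => ?; try lia); rewrite -cats1.
  rewrite !sweepS f0 f1 g0 g1 /sweep /= !cats0 !cats1 -!rcons_cons -!rcons_cat.
  by rewrite !delete_last_rcons -cats1 -!catA.
have f_low : sweep f k = sweep (levels s) k.
  apply: eq_sweep => j jk; rewrite fE !level1.
  by do ?(case: ifP => ?; try lia); rewrite cats0.
have f0 : f k.+1 = North :: levels s k.+1.
  by rewrite fE !level1; do ?(case: ifP => ?; try lia); rewrite cats0.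
have f00 : f k = East :: levels s k.
  by rewrite fE !level1; do ?(case: ifP => ?; try lia); rewrite cats0.
congr (delete_last (_ ++ _)).
rewrite !(sweepS _ k.+2) !(sweepS _ k.+1) g_low !sweepS f_low f1 f0 f00 g0 g1.
by rewrite -!catA.
Qed.

Lemma size_sweep m s :
  size (sweep (levels s) m) =
  sumn [seq ((0 <= x < m%:Z)%R + (0 < x <= m%:Z)%R)%N | x <- s].
Proof.
elim: m => [|m IHm]; first by elim: s => //= x s <-; lia.
rewrite sweepS size_cat IHm; elim: {IHm} s => //= x s <-.
by rewrite {1}/levels level_cons -/(levels s m); do ?(case: ifP => ? /=; try lia).
Qed.

(** The central 0 gives one letter. A pair [x], [- x] gives two: both from the positive entry, or
    one from each if [x = 0]. *)
Lemma size_sweep_mirror m s : (0 < m)%N -> (forall x, x \in s -> `|x| < m%:Z) ->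
  size (sweep (levels (mirror s)) m) = (2 * size s).+1.
Proof.
move=> m_gt0 bs; rewrite size_sweep /mirror map_cat sumn_cat map_rev sumn_rev /=.
elim: s bs => [|x s IHs] bs /=; first by lia.
have bx : `|x| < m%:Z by apply: bs; rewrite mem_head.
have /IHs : forall y, y \in s -> `|y| < m%:Z.
  by move=> y ys; apply: bs; rewrite inE ys orbT.
lia.
Qed.

(** * Counting ballot paths *)

Fixpoint words (m : nat) : seq (seq step) :=
  if m is m'.+1 then [seq North :: w | w <- words m'] ++ [seq East :: w | w <- words m']
  else [:: [::]].

Lemma mem_words m w : (w \in words m) = (size w == m).
Proof.
elim: m w => [|m IHm] w /=; first by rewrite inE size_eq0.
rewrite mem_cat; case: w => [|a w] /=.
  by rewrite eqE /=; apply/norP; split; apply/mapP => [[]].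
rewrite eqSS -IHm; apply/orP/idP => [[] /mapP [v vm [_ ->]] //|wm].
by case: a; [left | right]; apply: map_f.
Qed.

Lemma words_uniq m : uniq (words m).
Proof.
elim: m => //= m IHm; rewrite cat_uniq !map_inj_uniq ?IHm; try by move=> ? ? [].
by rewrite andbT /=; apply/hasPn => _ /mapP [w _ ->]; apply/mapP => [[]].
Qed.

Definition walk_end (w : seq step) : int :=
  (count_mem North w)%:Z - (count_mem East w)%:Z.

Fixpoint stays_nonneg (h : nat) (w : seq step) : bool :=
  match w with
  | [::] => true
  | a :: w' => if a then stays_nonneg h.+1 w'
               else if h is h'.+1 then stays_nonneg h' w' else false
  end.

(* Both sides satisfy the same recursion in [m]: a first step splits the window
   [-h, h + 1] into its two translates by 1, which have the same union and
   intersection as the windows for [h + 1] and [h - 1]. *)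
Lemma count_stays_nonneg h m :
  count (stays_nonneg h) (words m) =
  count (fun w => - h%:Z <= walk_end w <= h%:Z + 1) (words m).
Proof.
elim: m h => [|m IHm] h.
  by rewrite /= /walk_end /=; have -> : - h%:Z <= 0 - 0 <= h%:Z + 1 by lia.
rewrite /= !count_cat !count_map.
have eN : count (preim (cons North) (fun w => - h%:Z <= walk_end w <= h%:Z + 1)) (words m)
    = count (fun w => - h%:Z - 1 <= walk_end w <= h%:Z) (words m).
  by apply: eq_count => w; rewrite /= /walk_end /=; lia.
have eE : count (preim (cons East) (fun w => - h%:Z <= walk_end w <= h%:Z + 1)) (words m)
    = count (fun w => - h%:Z + 1 <= walk_end w <= h%:Z + 2) (words m).
  by apply: eq_count => w; rewrite /= /walk_end /=; lia.
rewrite eN eE -[in RHS]count_predUI.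
rewrite (@eq_count _ (preim (cons North) _) (stays_nonneg h.+1)) // IHm.
congr (_ + _)%N; first by apply: eq_count => w /=; lia.
(* At height 0 an [East] step is illegal, and the translated windows [[-1, 0]] and [[1, 2]] are
   disjoint. *)
case: h {eN eE} => [|h].
  rewrite (@eq_count _ _ pred0) // count_pred0.
  by rewrite (@eq_count _ _ pred0) ?count_pred0 // => w /=; lia.
rewrite (@eq_count _ _ (stays_nonneg h)) // IHm.
by apply: eq_count => w /=; lia.
Qed.

Lemma stays_nonnegP h w :
  reflect (forall u, prefix u w -> (count_mem East u <= count_mem North u + h)%N)
          (stays_nonneg h w).
Proof.
elim: w h => [|[] w IHw] h /=.
- by apply: ReflectT => -[].
- apply: (iffP (IHw _)) => Hw [|a u] //=.
    by case/andP=> /eqP -> /Hw /=; lia.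
  by move=> uw; have /= := Hw (North :: a :: u) uw; lia.
case: h => [|h].
  by apply: ReflectF => /(_ [:: East]); rewrite prefix0s => /(_ isT).
apply: (iffP (IHw _)) => Hw [|a u] //=.
  by case/andP=> /eqP -> /Hw /=; lia.
by move=> uw; have /= := Hw (East :: a :: u) uw; lia.
Qed.

Lemma size_count (w : seq step) : size w = (count_mem North w + count_mem East w)%N.
Proof. by elim: w => //= -[] w ->; rewrite ?addnS. Qed.

(** Even length makes [walk_end] even, so the window [[0, 1]] allows only 0; it is the window of
    [count_stays_nonneg] for [h = 0]. *)
Lemma lattice_pathsP n w :
  reflect (lattice_paths n w) ((size w == (2 * n)%N) && (0 <= walk_end w <= 1)).
Proof.
rewrite /walk_end size_count; apply: (iffP idP) => [|[-> ->]]; last lia.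
by move=> H; split; lia.
Qed.

Lemma ballot_pathsP m w :
  reflect (ballot_paths m w) ((size w == m) && stays_nonneg 0 w).
Proof.
apply: (iffP andP) => [[/eqP sz /stays_nonnegP Hw]|[sz Hw]].
  by split=> // u /Hw; rewrite addn0.
by split; [apply/eqP | apply/stays_nonnegP => u /Hw; rewrite addn0].
Qed.

Lemma lattice_to_ballot_bij n f :
  (forall w, lattice_paths n w -> ballot_paths (2 * n)%N (f w)) ->
  (forall v w, lattice_paths n v -> lattice_paths n w -> f v = f w -> v = w) ->
  set_bij (lattice_paths n) (ballot_paths (2 * n)%N) f.
Proof.
move=> fB f_inj; pose L := [seq w <- words (2 * n) | 0 <= walk_end w <= 1].
pose B := [seq w <- words (2 * n) | stays_nonneg 0 w].
have LP w : reflect (lattice_paths n w) (w \in L).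
  by rewrite mem_filter mem_words andbC; apply: lattice_pathsP.
have BP w : reflect (ballot_paths (2 * n)%N w) (w \in B).
  by rewrite mem_filter mem_words andbC; apply: ballot_pathsP.
split=> [//|v w|w /BP wB]; first by rewrite !inE; apply: f_inj.
have [] := @uniq_min_size _ [seq f v | v <- L] B.
- rewrite map_inj_in_uniq ?filter_uniq ?words_uniq // => u v /LP uL /LP vL.
  exact: f_inj.
- by move=> _ /mapP [v /LP vL ->]; apply/BP/fB.
- by rewrite size_map !size_filter count_stays_nonneg.
by move=> _ /(_ w); rewrite wB => /mapP [v /LP vL ->]; exists v.
Qed.

(** * Area vectors *)

Arguments easts_before_norths : simpl never.

Lemma easts_before_norths_cons a w : easts_before_norths (a :: w) =
  if a then 0%N :: easts_before_norths w
  else [seq k.+1 | k <- easts_before_norths w].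
Proof.
have shift : [seq count_mem East (take k (a :: w)) |
     k <- [seq i <- iota 1 (size w) | nth East (a :: w) i == North]] =
   [seq ((a == East) + k)%N | k <- easts_before_norths w].
  rewrite (iotaDl 1 0) filter_map -!map_comp.
  by apply: eq_map.
rewrite /easts_before_norths /=; case: a shift => shift.
  by rewrite /= shift (@eq_map _ _ _ id) ?map_id.
by rewrite /= shift.
Qed.

Lemma size_easts_before_norths w : size (easts_before_norths w) = count_mem North w.
Proof.
elim: w => // -[] w IHw; rewrite easts_before_norths_cons; first by rewrite /= IHw.
by rewrite size_map IHw.
Qed.

Lemma easts_before_norths_sorted w : sorted leq (easts_before_norths w).
Proof.
elim: w => // -[] w IHw; rewrite easts_before_norths_cons.
  by rewrite /=; case: (easts_before_norths w) IHw.
by rewrite sorted_map.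
Qed.

Lemma easts_before_norths_le w k :
  k \in easts_before_norths w -> (k <= count_mem East w)%N.
Proof.
elim: w k => // -[] w IHw k; rewrite easts_before_norths_cons /=.
  by rewrite inE => /predU1P [->|/IHw].
by move=> /mapP [i /IHw le ->]; exact: le.
Qed.

(** The vector does not see the trailing [East] letters; their number comes from the total. *)
Lemma easts_before_norths_inj v w : count_mem East v = count_mem East w ->
  easts_before_norths v = easts_before_norths w -> v = w.
Proof.
elim: v w => [|a v IHv] [|b w] //.
- case: b => // _; by rewrite easts_before_norths_cons.
- case: a => // _; by rewrite easts_before_norths_cons.
rewrite !easts_before_norths_cons; case: a b => [] [] /=.
- by rewrite !add0n => eqE [eqw]; rewrite (IHv w).
- by case: (easts_before_norths w).
- by case: (easts_before_norths v).
rewrite !add1n => -[eqE] /inj_map eqw; congr (_ :: _); apply: IHv => //.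
by apply: eqw => ? ? [].
Qed.

(** * The zeta map as a sweep *)

Lemma read_word_opp j s : read_word (- j) (- j - 1) s = level j [seq - x | x <- s].
Proof.
elim: s => // x s IHs; rewrite level_cons -IHs /read_word /=.
have -> : (- x == j) = (x == - j) by lia.
have -> : (- x == j + 1) = (x == - j - 1) by lia.
by case: (x == - j) => //; case: (x == - j - 1).
Qed.

(** Reading [mu] backwards at negative levels is reading the mirrored half forwards; the extra
    [North] in [zetaB] is the central 0. *)
Lemma zetaB_sweep n w :
  zetaB n w = delete_last (sweep (levels (mirror (area_vector n w))) (2 * n).+1).
Proof.
set mu := area_vector n w; rewrite sweepSr delete_last_cat; last first.
  by rewrite -size_eq0 /levels /mirror level_cat size_cat level_cons eqxx addnS.
rewrite /zetaB -/mu; congr (_ ++ _).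
  rewrite /sweep (iotaDl 1 0) -map_rev -map_comp; congr flatten; apply: eq_map => j.
  rewrite /= /levels /mirror level_cat level_cons.
  have -> : (0 == (1 + j)%N%:Z) = false by lia.
  have -> : (0 == (1 + j)%N%:Z + 1) = false by lia.
  by rewrite /Sleft_neg read_word_opp map_rev.
rewrite /levels /mirror level_cat level_cons eqxx delete_last_cat //.
by rewrite /Sleft_neg read_word_opp map_rev.
Qed.

(* The representative of [b] modulo the rotation [b -> 1 - b]. *)
Definition nonpos_rep (b : int) : int := if b <= 0 then b else 1 - b.

Lemma sweep_nonpos_rep m s b : `|b| < m%:Z ->
  delete_last (sweep (levels (mirror (rcons s b))) m) =
  delete_last (sweep (levels (mirror (rcons s (nonpos_rep b)))) m).
Proof.
rewrite /nonpos_rep; case: ifP => // b_gt0 bm.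
have [k def_b] : exists k : nat, b = k%:Z + 1 by exists (`|b| - 1)%N; lia.
have -> : 1 - b = - k%:Z by lia.
rewrite !mirror_rcons opprK {}def_b in bm *; symmetry; apply: sweep_rotate; first by lia.
by rewrite mem_cat mem_head orbT.
Qed.

Lemma path_map_iota (T : Type) (e : rel T) (g : nat -> T) a k :
  (forall i, (a <= i < a + k)%N -> e (g i) (g i.+1)) ->
  path e (g a) [seq g i | i <- iota a.+1 k].
Proof.
elim: k a => //= k IHk a eg; rewrite eg ?IHk // => [i ik|]; last by lia.
apply: eg; lia.
Qed.

Section AreaVector.

Variables (n : nat) (w : seq step).
Hypotheses (n_ge2 : (2 <= n)%N) (w_path : lattice_paths n w).

Lemma pi_le i j : (0 < i <= j)%N -> (j <= n)%N -> (pi_ w i <= pi_ w j)%N.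
Proof.
move=> ij jn; apply: (sorted_leq_nth leq_trans leqnn _ (easts_before_norths_sorted w)).
- by rewrite inE size_easts_before_norths w_path.1; lia.
- by rewrite inE size_easts_before_norths w_path.1; lia.
lia.
Qed.

Lemma pi_bound i : (0 < i <= n)%N -> (pi_ w i <= n)%N.
Proof.
move=> i_n; rewrite -w_path.2; apply/easts_before_norths_le/mem_nth.
by rewrite size_easts_before_norths w_path.1; lia.
Qed.

Definition area_init : seq int := [seq (pi_ w i)%:Z - i%:Z | i <- iota 1 n.-1].

Lemma area_vectorE : area_vector n w = rcons area_init (mu_ n w n).
Proof.
have iota_n : iota 1 n = rcons (iota 1 n.-1) n.
  have {1}-> : n = (n.-1 + 1)%N by lia.
  by rewrite iotaD cats1 add1n prednK //; lia.
rewrite /area_vector iota_n map_rcons; congr rcons.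
apply/eq_in_map => i; rewrite mem_iota => i_n; rewrite /mu_ /lambda_.
by have -> : (i < n)%N by lia.
Qed.

Lemma area_init_path : path descent_ok 0 area_init.
Proof.
rewrite /area_init; have -> : n.-1 = n.-2.+1 by lia.
rewrite /=; apply/andP; split; first by rewrite /descent_ok; lia.
apply: (@path_map_iota _ _ (fun i => (pi_ w i)%:Z - i%:Z)) => i i_n.
have : (pi_ w i <= pi_ w i.+1)%N by apply: pi_le; lia.
by rewrite /descent_ok; lia.
Qed.

Lemma last_area_init : last 0 area_init = (pi_ w n.-1)%:Z - n.-1%:Z.
Proof.
rewrite /area_init; have {1}-> : n.-1 = (n.-2 + 1)%N by lia.
rewrite iotaD map_cat last_cat /= add1n.
by have -> : n.-2.+1 = n.-1 by lia.
Qed.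

(** With [a = 2 * pi_n - pi_(n-1) - n], the last entry is [a] or [1 - a] in all four cases. The
    interval is invariant under [b -> 1 - b], so [nonpos_rep] stays in it, and its lower end is
    exactly one below the previous entry. *)
Lemma mu_last_bounds :
  (pi_ w n.-1)%:Z - n%:Z <= mu_ n w n <= n%:Z + 1 - (pi_ w n.-1)%:Z.
Proof.
have := @pi_le n.-1 n; have := @pi_bound n.
rewrite /mu_ /lambda_ ltnn; case: ifP => _; case: ifP => _; lia.
Qed.

Let mu' := rcons area_init (nonpos_rep (mu_ n w n)).

Lemma area_rep_path : path descent_ok 0 mu'.
Proof.
rewrite rcons_path area_init_path last_area_init /descent_ok /nonpos_rep /=.
by have := mu_last_bounds; case: ifP; lia.
Qed.

Lemma area_rep_last : last 0 mu' <= 0.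
Proof. by rewrite last_rcons /nonpos_rep; case: ifP; lia. Qed.

Lemma area_init_bound x : x \in area_init -> `|x| <= n%:Z.
Proof.
move=> /mapP [i]; rewrite mem_iota => i_n ->.
by have := @pi_bound i; lia.
Qed.

Lemma area_rep_bound x : x \in mu' -> `|x| < (2 * n).+1%:Z.
Proof.
rewrite mem_rcons inE => /predU1P [->|/area_init_bound]; last by lia.
by have := mu_last_bounds; rewrite /nonpos_rep; case: ifP; lia.
Qed.

Lemma zetaBE : zetaB n w = delete_last (sweep (levels (mirror mu')) (2 * n).+1).
Proof.
rewrite zetaB_sweep area_vectorE sweep_nonpos_rep //.
by have := mu_last_bounds; lia.
Qed.

(** The deleted letter is always [North], so the deletion loses no information. *)
Lemma sweep_area_rep :
  sweep (levels (mirror mu')) (2 * n).+1 = rcons (zetaB n w) North.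
Proof.
have last_levels j := levels_last _ j area_rep_path area_rep_last.
have := @last_sweep (levels (mirror mu')) (2 * n).+1 last_levels.
have := @size_sweep_mirror (2 * n).+1 mu' isT area_rep_bound.
rewrite zetaBE; case/lastP: (sweep _ _) => // u a _.
by rewrite last_rcons delete_last_rcons => ->.
Qed.

Lemma zetaB_ballot : ballot_paths (2 * n)%N (zetaB n w).
Proof.
have sz := @size_sweep_mirror (2 * n).+1 mu' isT area_rep_bound.
rewrite sweep_area_rep !size_rcons size_map size_iota in sz.
split=> [|u u_pre]; first by case: sz => ->; lia.
have : prefix u (sweep (levels (mirror mu')) (2 * n).+1).
  by rewrite sweep_area_rep -cats1; apply: prefix_catl.
(* No entry reaches [2n + 1], so the extra term of [sweep_ballot] vanishes. *)
have /count_memPn out : (2 * n).+1%:Z \notin mirror mu'.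
  by apply/negP => /mem_mirror /or3P [/eqP //|/area_rep_bound|/area_rep_bound]; lia.
by move/(sweep_ballot _ (levels_count _)); rewrite count_North_level out addn0.
Qed.

End AreaVector.

Lemma zetaB_inj n v w : (2 <= n)%N -> lattice_paths n v -> lattice_paths n w ->
  zetaB n v = zetaB n w -> v = w.
Proof.
move=> n_ge2 pv pw eq_zeta.
have : rcons (area_init n v) (nonpos_rep (mu_ n v n)) =
       rcons (area_init n w) (nonpos_rep (mu_ n w n)).
  apply: (@sweep_levels_inj (2 * n).+1) => //; try exact: area_rep_path;
    try exact: area_rep_last; try exact: area_rep_bound.
  by rewrite !sweep_area_rep ?eq_zeta.
move/rcons_inj => [eq_init eq_rep].
have eq_pi i : (0 < i < n)%N -> pi_ v i = pi_ w i.
  move=> i_n; have : i \in iota 1 n.-1 by rewrite mem_iota; lia.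
  by move/eq_in_map: eq_init => /[apply] /=; lia.
have eq_last : pi_ v n = pi_ w n.
  have eq_sum : (\sum_(1 <= k < n.-1) pi_ v k = \sum_(1 <= k < n.-1) pi_ w k)%N.
    by apply: eq_big_nat => i i_n; apply: eq_pi; lia.
  (* Both paths fall into the same cases of [lambda_] and [mu_], and share [pi_(n-1)], so their last
     entries have the same parity. As [b] and [1 - b] have opposite parities, equal representatives
     force equal entries. *)
  move: eq_rep; rewrite /nonpos_rep /mu_ /lambda_ ltnn eq_sum (eq_pi n.-1); last by lia.
  by case: ifP => _; case: ifP => _; case: ifP => ?; case: ifP => ?; lia.
apply: easts_before_norths_inj; first by rewrite pv.2 pw.2.
apply: (@eq_from_nth _ 0%N); first by rewrite !size_easts_before_norths pv.1 pw.1.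
move=> i; rewrite size_easts_before_norths pv.1 => i_n.
case: (eqVneq i.+1 n) => [def_n|ne_n]; first by move: eq_last; rewrite -def_n.
by apply: (eq_pi i.+1); lia.
Qed.

Theorem theorem6p18 (n : nat) (hn : (2 <= n)%N) :
  set_bij (lattice_paths n) (ballot_paths (2 * n)%N) (zetaB n).
Proof.
apply: lattice_to_ballot_bij => [w|v w]; first exact: zetaB_ballot.
exact: zetaB_inj.
Qed.
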